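(* Let $X$ be a Tychonoff space. The Stone-Čech compactification $\beta X$ is an indecomposable continuum if and only if $X$ is strongly indecomposable and connected.
   Context: A continuum is a connected compact Hausdorff space; it is indecomposable if it cannot be written as the union of two of its proper subcontinua. Equivalently, every connected subset is either dense or nowhere dense. A topological space $X$ is strongly indecomposable if for every two non-empty disjoint open sets $U,V\subseteq X$ there are two closed sets $A,B\subseteq X$ such that $X=A\cup B$, $A\cap U\neq\varnothing$, $B\cap U\neq\varnothing$, and $A\cap B\subseteq V$. *)

(* Defs.v *)
From HB Require Import structures.
From mathcomp Require Import all_boot all_order all_algebra.
From mathcomp Require Import all_classical all_reals all_analysis.

Set Implicit Arguments.
Unset Strict Implicit.
Unset Printing Implicit Defensive.

Import Order.TTheory GRing.Theory Num.Theory.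
Import numFieldNormedType.Exports.
Local Open Scope classical_set_scope.
Local Open Scope ring_scope.

(* By [uniform_separatorP], [completely_regular_space] is separation of points
   from closed sets by continuous functions into [0,1]. *)
Definition tychonoff_space (X : topologicalType) : Prop :=
  completely_regular_space X /\ accessible_space X.

Definition unit_interval (R : realType) : topologicalType :=
  set_type (`[0, 1]%classic : set R).

Definition stone_cech_cube (R : realType) (X : topologicalType) :
    topologicalType :=
  prod_topology (fun _ : continuousType X (unit_interval R) => unit_interval R).

Definition stone_cech_eval (R : realType) (X : topologicalType) :
    X -> stone_cech_cube R X :=
  join_product (fun (f : continuousType X (unit_interval R)) => (f : X -> _)).

(* The Stone-Cech compactification is the closure of the image of X in the
   cube [0,1]^C(X,[0,1]) under x |-> (f |-> f x), with the subspace topology. *)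
Definition stone_cech (R : realType) (X : topologicalType) : topologicalType :=
  set_type (closure (range (@stone_cech_eval R X))).

Definition continuum (T : topologicalType) : Prop :=
  [/\ connected [set: T], compact [set: T] & hausdorff_space T].

(* Only used inside a Hausdorff space, where every subspace is Hausdorff.
   The empty set is allowed; this does not affect indecomposability, since the
   other piece of a decomposition would then be the whole space. *)
Definition subcontinuum (T : topologicalType) (A : set T) : Prop :=
  connected A /\ compact A.

Definition indecomposable_continuum (T : topologicalType) : Prop :=
  continuum T /\
  ~ exists A B : set T,
      [/\ subcontinuum A, subcontinuum B, A != setT, B != setT
        & A `|` B = setT].

Definition strongly_indecomposable (X : topologicalType) : Prop :=
  forall U V : set X,
    open U -> open V -> U !=set0 -> V !=set0 -> U `&` V = set0 ->
    exists A B : set X,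
      [/\ closed A /\ closed B, A `|` B = setT,
          A `&` U !=set0, B `&` U !=set0 & A `&` B `<=` V].

(* Main.v *)
Require Import Defs.
From mathcomp Require Import all_boot all_order all_algebra.
From mathcomp Require Import all_classical all_reals all_analysis.
From mathcomp Require Import lra.

Set Implicit Arguments.
Unset Strict Implicit.
Unset Printing Implicit Defensive.

Import Order.TTheory GRing.Theory Num.Theory.
Import numFieldNormedType.Exports.
Local Open Scope classical_set_scope.
Local Open Scope ring_scope.

(** Write K for the Stone-Cech compactification of X and e : X -> K for the
    canonical map. Apart from K being compact Hausdorff, only two facts about
    the pair matter: e has dense range, and every continuous f : X -> [0,1]
    factors through e. The proof moves between X and K by extending functions,
    and polynomial identities between continuous real functions survive the
    extension because they hold on a dense set.

    If K is an indecomposable continuum, then K itself is strongly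
    indecomposable ([indecomposable_continuum_strongly]). Indeed, let U and V be
    disjoint nonempty open sets and shrink V to an open W with closure in V. A
    proper subcontinuum of K has empty interior, so U cannot lie in a component
    of the compact set L = K minus W. In a compact Hausdorff space components
    are quasi-components, so some clopen piece C of L splits U, and C and
    L minus C, each enlarged by the closure of W, are the two closed sets
    required. Their traces on X work for X, because complete regularity provides
    enough open sets of K ([strongly_indecomposable_of_extension]). X is
    connected because the indicator of a clopen subset extends to K with values
    in {0,1} ([connected_of_extension]).

    Conversely, K is connected as the closure of the image of X. Suppose that K
    is the union of proper subcontinua A and B, and pick v outside A. Strong
    indecomposability of X, applied to the traces of the complement of B (which
    lies in A) and of a neighbourhood N of v (which is away from A), gives
    closed C and D. These need not have disjoint closures in K away from N, as X
    need not be normal. Instead, let psi be 0 on N and 1 on A. The functions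
    (1 + psi)/2 on C and (1 - psi)/2 on D agree on the overlap of C and D, where
    psi vanishes, so they paste to a function on X; its extension g satisfies
    (g - (1 + psi)/2) (g - (1 - psi)/2) = 0 on K, hence takes only the values 0
    and 1 on A, and takes both. This contradicts the connectedness of A
    ([indecomposable_of_extension]). *)

(** * Connectedness of closed sets *)

Lemma closed_connectedP (T : topologicalType) (A : set T) : closed A ->
  connected A <-> forall E F : set T, closed E -> closed F ->
    A = E `|` F -> E `&` F = set0 -> E = set0 \/ F = set0.
Proof.
move=> cA; split=> [conA E F cE cF AEF EF0|H B B0 [C oC BC] [D cD BD]].
  have [->|/set0P E0] := eqVneq E set0; [by left|right].
  have EA : E = A.
    apply: conA => //.
      exists (~` F); first exact: closed_openC.
      by rewrite AEF setIUl setICr setU0; apply/esym/setIidPl/disjoints_subset.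
    by exists E => //; rewrite AEF; apply/esym/setIidPr; exact: subsetUl.
  by apply/seteqP; split=> // x Fx; rewrite -EF0; split=> //; rewrite EA AEF; right.
have [||||/seteqP[+ _]|AC0] := H (A `&` D) (A `&` ~` C).
- exact: closedI.
- by apply: closedI => //; exact: open_closedC.
- by rewrite -BD BC -setIUr setUCr setIT.
- by rewrite -BD BC setIACA setICr setI0.
- by rewrite -BD; case: B0 => x Bx /(_ x Bx).
- rewrite BC; apply/setIidPl => x Ax; apply: contrapT => nCx.
  by suff : set0 x by []; rewrite -AC0.
Qed.

(** A clopen subset of A `|` P disjoint from A lies in P, so it is separated from
    Q as well and is clopen in the whole space. *)
Lemma connected_setU_clopen_complement (T : topologicalType) (A P Q : set T) :
  connected [set: T] -> connected A -> closed A -> closed P -> closed Q ->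
  P `&` Q = set0 -> A `|` P `|` Q = setT -> connected (A `|` P).
Proof.
move=> /(closed_connectedP closedT) conT /[swap] cA /(closed_connectedP cA) conA.
move=> cP cQ PQ0 APQ.
apply/(closed_connectedP (closedU cA cP)) => E F cE cF APEF EF0.
have AEF : A = (A `&` E) `|` (A `&` F).
  by rewrite -setIUr -APEF; apply/esym/setIidPl; exact: subsetUl.
wlog AF0 : E F cE cF APEF EF0 AEF / A `&` F = set0.
  move=> wl; have [||||AE0|AF0] := conA (A `&` E) (A `&` F).
  - exact: closedI.
  - exact: closedI.
  - by [].
  - by rewrite setIACA EF0 setI0.
  - by rewrite or_comm; apply: wl => //;
      [rewrite [RHS]setUC | rewrite setIC | rewrite [RHS]setUC].
  - exact: wl.
have FP : F `<=` P.
  move=> x Fx; have [Ax|//] : (A `|` P) x by rewrite APEF; right.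
  by have : (A `&` F) x by []; rewrite AF0.
have [|||||] := conT (E `|` Q) F.
- exact: closedU.
- by [].
- by rewrite -APQ APEF setUAC.
- rewrite setIUl EF0 set0U; apply/seteqP; split=> // x [Qx /FP Px].
  by rewrite -PQ0.
- by move=> EQ0; left; apply/seteqP; split=> // x Ex; rewrite -EQ0; left.
- by right.
Qed.

(** * Indecomposable continua are strongly indecomposable *)

(** Let W be the closure of the complement of A, which is proper when A has
    interior. If W is connected, then A and W decompose K. Otherwise W splits into
    closed pieces P and Q, and A `|` P and A `|` Q decompose K. *)
Lemma proper_subcontinuum_interior (K : topologicalType) (A : set K) :
  indecomposable_continuum K -> subcontinuum A -> A != setT -> A° = set0.
Proof.
move=> [[conK coK hK] indec] [conA coA] AT.
have [//|/set0P[x Aox]] := eqVneq (A°) set0; exfalso.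
have cA := compact_closed hK coA.
pose W := closure (~` A).
have cW : closed W by exact: closed_closure.
have AW : A `|` W = setT.
  apply/seteqP; split=> // y _; have [Ay|nAy] := pselect (A y); first by left.
  by right; exact: subset_closure.
have sub (P : set K) : closed P -> connected P -> subcontinuum P.
  by move=> cP conP; split=> //; exact: (subclosed_compact cP coK (@subsetT _ _)).
apply: indec.
have [conW|] := pselect (connected W).
  exists A, W; split => //; first exact: sub.
  by apply/eqP => /seteqP[_ /(_ x Logic.I)]; rewrite /W closure_setC; exact.
move=> /(closed_connectedP cW)/existsNP[P]/existsNP[Q].
move=> /not_implyP[cP]/not_implyP[cQ]/not_implyP[WPQ]/not_implyP[PQ0].
move=> /not_orP[/eqP P0 /eqP Q0].
(* If A and P' covered K then the complement of A, hence also its closure,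
   would lie in P', leaving nothing for Q'. *)
have proper (P' Q' : set K) : closed P' -> W = P' `|` Q' -> P' `&` Q' = set0 ->
    Q' != set0 -> A `|` P' != setT.
  move=> cP' WPQ' PQ' /set0P[y Qy]; apply/eqP => AP.
  have WP : W `<=` P'.
    rewrite (_ : P' = closure P'); last exact/closure_id.
    apply: closureS => z nAz; have : (A `|` P') z by rewrite AP.
    by case.
  suff : set0 y by [].
  by rewrite -PQ'; split=> //; apply: WP; rewrite WPQ'; right.
exists (A `|` P), (A `|` Q); split.
- apply: sub; first exact: closedU.
  by apply: (connected_setU_clopen_complement _ _ _ _ cQ) => //; rewrite -setUA -WPQ.
- apply: sub; first exact: closedU.
  apply: (connected_setU_clopen_complement _ _ _ _ cP) => //; first by rewrite setIC.
  by rewrite -setUA (setUC Q) -WPQ.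
- exact: (proper _ Q).
- by apply: (proper _ P) => //; [rewrite [RHS]setUC | rewrite setIC].
- by rewrite setUACA setUid -WPQ.
Qed.

(** The relatively clopen subsets of L that contain u; their intersection is the
    quasi-component of u in L. *)
Definition clopen_in_at (T : topologicalType) (L : set T) (u : T) (C : set T) :=
  [/\ closed C, closed (L `\` C), C `<=` L & C u].

(** Suppose that the quasi-component Q of u in L splits into closed pieces E and F,
    with u in E, and separate them by disjoint open G1 and G2. By compactness, some
    clopen neighbourhood C of u in L already lies in G1 `|` G2. Then C minus G2 is
    again clopen in L, and it contains u but misses F, so F is empty. *)
Lemma quasi_component_connected (T : topologicalType) (L : set T) (u : T) :
  hausdorff_space T -> compact [set: T] -> closed L -> L u ->
  connected (\bigcap_(C in clopen_in_at L u) C).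
Proof.
move=> hT coT cL Lu; set Q := \bigcap_(C in _) C.
have clL : clopen_in_at L u L.
  by split=> //; rewrite setDv; exact: closed0.
have cQ : closed Q by apply: closed_bigI => C [].
have clI C D : clopen_in_at L u C -> clopen_in_at L u D ->
    clopen_in_at L u (C `&` D).
  move=> [cC cC' CL Cu] [cD cD' DL Du]; split=> //; first exact: closedI.
    by rewrite setDIr; exact: closedU.
  by move=> x [/CL].
apply/(closed_connectedP cQ) => E F cE cF QEF EF0.
wlog Eu : E F cE cF QEF EF0 / E u.
  move=> wl; have : Q u by move=> C [].
  rewrite QEF => -[Eu|Fu]; first exact: (wl E F).
  by rewrite or_comm; apply: wl => //; [rewrite [RHS]setUC | rewrite setIC].
right.
have [V /set_nbhsP[G1 [oG1 EG1 G1V]] VF] :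
    exists2 V, set_nbhs E V & closure V `<=` ~` F.
  apply: compact_normal => //; apply/set_nbhsP; exists (~` F); split=> //.
    exact: closed_openC.
  exact/disjoints_subset.
pose G2 := ~` closure V.
have oG2 : open G2 by exact/closed_openC/closed_closure.
have FG2 : F `<=` G2 by move=> x Fx /VF.
have G12 x : G1 x -> G2 x -> False by move=> /G1V/subset_closure.
(* Otherwise the sets C minus G1 `|` G2 generate a proper filter, whose cluster
   points lie in Q but outside G1 `|` G2. *)
have [C clC CO] : exists2 C, clopen_in_at L u C & C `<=` G1 `|` G2.
  apply: contrapT => noC.
  pose B C := C `&` ~` (G1 `|` G2).
  have BF : ProperFilter (filter_from (clopen_in_at L u) B).
    apply: filter_from_proper.
      apply: filter_from_filter; first by exists L.
      move=> C D clC clD; exists (C `&` D); first exact: clI.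
      by move=> x [[Cx Dx] nO].
    move=> C clC; apply: contrapT => B0; apply: noC; exists C => // x Cx.
    by apply: contrapT => nO; apply: B0; exists x.
  have [|p [_ pB]] := coT _ BF; first by exists L.
  have pcl C : clopen_in_at L u C -> B C p.
    move=> clC; have cB : closed (B C).
      by apply: closedI; [case: clC | exact/open_closedC/openU].
    move: cB => /closure_id ->; move: pB; rewrite clusterE; apply.
    by exists C.
  have [_ nO] := pcl _ clL; apply: nO.
  have : Q p by move=> C /pcl[].
  by rewrite QEF => -[/EG1|/FG2]; [left|right].
have [cC cC' CL Cu] := clC.
have clCO : clopen_in_at L u (C `\` G2).
  split.
  - by rewrite setDE; apply: closedI => //; exact: open_closedC.
  - suff -> : L `\` (C `\` G2) = (L `\` C) `|` (C `&` ~` G1).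
      by apply: closedU => //; apply: closedI => //; exact: open_closedC.
    apply/seteqP; split=> x.
      move=> [Lx nCO]; have [Cx|] := pselect (C x); last by left.
      right; split=> // G1x; apply: nCO; split=> //; exact: G12.
    move=> [[Lx nCx]|[Cx nG1]]; first by split=> // -[].
    split; first exact: CL.
    by move=> [_]; apply; case: (CO _ Cx).
  - by move=> x [/CL].
  - split=> // G2u; exact: (G12 u (EG1 _ Eu)).
apply/seteqP; split=> // x Fx.
have : Q x by rewrite QEF; right.
by move=> /(_ _ clCO) [_ /(_ (FG2 _ Fx))].
Qed.

(** The quasi-component of a point of U in L, the complement of a small open
    W inside V, is a proper subcontinuum, so it cannot contain U: a clopen piece
    of L must split U. *)
Lemma indecomposable_continuum_strongly (K : topologicalType) :
  indecomposable_continuum K -> strongly_indecomposable K.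
Proof.
move=> indK; have [[_ coK hK] _] := indK.
move=> U V oU oV [u Uu] [v Vv] UV0.
have [N nN NV] : exists2 N, nbhs v N & closure N `<=` V.
  by apply: (compact_regular hK coK); [exact: filterT | exact: open_nbhs_nbhs].
pose W := N°; pose L := ~` W.
have oW : open W by exact: open_interior.
have Wv : W v by [].
have cWV : closure W `<=` V.
  by apply: subset_trans NV; apply: closureS; exact: interior_subset.
have cL : closed L by exact: open_closedC.
have UL : U `<=` L.
  move=> x Ux Wx; suff : set0 x by [].
  by rewrite -UV0; split=> //; apply/cWV/subset_closure.
have Lu := UL _ Uu.
pose Q := \bigcap_(C in clopen_in_at L u) C.
have [UQ|] := pselect (U `<=` Q).
  exfalso.
  have cQ : closed Q by apply: closed_bigI => C [].
  have QL : Q `<=` L.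
    by move=> x; apply; split=> //; rewrite setDv; exact: closed0.
  have : Q° = set0.
    apply: proper_subcontinuum_interior => //; first split.
    - exact: quasi_component_connected.
    - exact: (subclosed_compact cQ coK (@subsetT _ _)).
    - by apply/eqP => /seteqP[_ /(_ v Logic.I)] /QL.
  move=> /seteqP[/(_ u)] + _; apply.
  by apply: (interiorS UQ); exact: open_nbhs_nbhs.
move=> /existsNP[y] /not_implyP[Uy /existsNP[C] /not_implyP[clC nCy]].
have [cC cC' CL Cu] := clC.
exists (C `|` closure W), ((L `\` C) `|` closure W); split.
- by split; apply: closedU => //; exact: closed_closure.
- apply/seteqP; split=> // x _.
  have [Wx|Lx] := pselect (W x); first by left; right; exact: subset_closure.
  by have [Cx|nCx] := pselect (C x); [left; left | right; left].
- by exists u; split=> //; left.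
- by exists y; split=> //; left; split=> //; exact: UL.
- by rewrite -setUIl setDE setICA setICr setI0 set0U.
Qed.

(** * Spaces to which unit-valued functions extend *)

Lemma continuous_patch (T U : topologicalType) (C D : set T) (f g : T -> U) :
  closed C -> closed D -> C `|` D = setT -> continuous f -> continuous g ->
  {in C `&` D, f =1 g} -> continuous (patch g C f).
Proof.
move=> cC cD CD cf cg fg; apply/continuous_subspace_setT; rewrite -CD.
apply: withinU_continuous => //.
  apply: (subspace_eq_continuous (f := f)); last exact: continuous_subspaceT.
  by move=> x xC; rewrite /from_subspace patchT.
apply: (subspace_eq_continuous (f := g)); last exact: continuous_subspaceT.
move=> x xD; rewrite /from_subspace /patch; case: ifPn => // xC.
by apply/esym/fg; rewrite inE; split; apply/set_mem.
Qed.

(** The image of A would be an interval containing 0 and 1 but not 1/2. *)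
Lemma connected_two_values (R : realType) (T : topologicalType) (A : set T)
    (g : T -> R) (a b : T) :
  connected A -> continuous g -> (forall x, A x -> g x * (g x - 1) = 0) ->
  A a -> A b -> g a = 0 -> g b = 1 -> False.
Proof.
move=> conA cg g01 Aa Ab ga gb.
have /connected_intervalP gA : connected (g @` A).
  by apply: connected_continuous_connected => //; exact: continuous_subspaceT.
have [|||x Ax gx] := gA 0 1 _ _ (2^-1).
- by exists a.
- by exists b.
- by apply/andP; split; lra.
- by have := g01 x Ax; rewrite gx; lra.
Qed.

Lemma dense_range_eq0 (R : realType) (X K : topologicalType) (e : X -> K)
    (h : K -> R) :
  dense (range e) -> continuous h -> (forall x, h (e x) = 0) ->
  forall y, h y = 0.
Proof.
move=> de ch he y; apply: contrapT => hy.
have oN : open (h @^-1` (~` [set 0])).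
  apply: open_comp => [x _|]; first exact: ch.
  by apply: closed_openC; exact: closed_eq.
have [|z [hz [x _ xz]]] := de _ _ oN; first by exists y.
by apply: hz; rewrite /= -xz.
Qed.

(** The existence half of the universal property of the Stone-Cech
    compactification, for the target [0,1]. *)
Definition extends_unit_valued (R : realType) (X K : topologicalType)
    (e : X -> K) :=
  forall f : X -> R, continuous f -> (forall x, 0 <= f x <= 1) ->
    exists2 g : K -> R, continuous g & forall x, g (e x) = f x.

(** A splitting of X into clopen E and F is a continuous function f that is 0 on E
    and 1 on F. The identity f (f - 1) = 0 passes to the extension of f, which
    then disconnects K. *)
Lemma connected_of_extension (R : realType) (X K : topologicalType)
    (e : X -> K) :
  dense (range e) -> extends_unit_valued R e ->
  connected [set: K] -> connected [set: X].
Proof.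
move=> de ext conK; apply/(closed_connectedP closedT) => E F cE cF EF EF0.
apply: contrapT => /not_orP[/eqP/set0P[a Ea] /eqP/set0P[b Fb]].
pose f : X -> R := patch (cst 1) E (cst 0).
have fE x : E x -> f x = 0 by move=> Ex; rewrite /f /patch mem_set.
have fF x : F x -> f x = 1.
  move=> Fx; rewrite /f /patch memNset// => Ex.
  by suff : set0 x by []; rewrite -EF0.
have EorF x : E x \/ F x by have : [set: X] x by []; rewrite EF.
have cf : continuous f.
  apply: (continuous_patch cE cF) => //; [exact: cst_continuous..|].
  by move=> x; rewrite EF0 inE.
have [x|g cg gf] := ext f cf.
  by case: (EorF x) => [/fE|/fF] ->; rewrite lexx ler01.
apply: (@connected_two_values _ _ _ g (e a) (e b) conK cg) => //.
- move=> y _; apply: (@dense_range_eq0 _ _ _ e (fun y => g y * (g y - 1)) de).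
    move=> z; apply: cvgM; first exact: cg.
    by apply: cvgB; [exact: cg | exact: cvg_cst].
  by move=> x; rewrite gf; case: (EorF x) => [/fE|/fF] ->; lra.
- by rewrite gf fE.
- by rewrite gf fF.
Qed.

(** Take f equal to 0 at a point of U and to 1 off U, and let U' be the set where
    the extension of f is below 1. *)
Lemma open_trace (R : realType) (X K : topologicalType) (e : X -> K)
    (U : set X) :
  completely_regular_space X -> extends_unit_valued R e ->
  open U -> U !=set0 ->
  exists U' : set K,
    [/\ open U', e @^-1` U' !=set0 & e @^-1` U' `<=` U].
Proof.
move=> crX ext oU [u Uu].
have /(@uniform_separatorP _ R)[f [cf f01 fu fU]] :
    uniform_separator [set u] (~` U).
  by apply: crX; [exact: open_closedC | exact].
have [x|g cg gf] := ext f cf.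
  by have /= := f01 (f x); rewrite in_itv/=; apply; exists x.
exists (g @^-1` [set y | y < 1]); split.
- by apply: open_comp => [x _|]; [exact: cg | exact: open_lt].
- by exists u; rewrite /= gf (fu (f u)) ?ltr01//; exists u.
- move=> x /=; rewrite gf => fx; apply: contrapT => nUx.
  by move: fx; rewrite (fU (f x)) ?ltxx//; exists x.
Qed.

(** Pull back closed sets A and B obtained in K for open sets with trace inside U
    and V. A point of A in U' does not give a point of the trace of A by itself;
    density applies because A is open within U'. *)
Lemma strongly_indecomposable_of_extension (R : realType)
    (X K : topologicalType) (e : X -> K) :
  completely_regular_space X -> continuous e -> dense (range e) ->
  extends_unit_valued R e ->
  strongly_indecomposable K -> strongly_indecomposable X.
Proof.
move=> crX ce de ext siK U V oU oV U0 V0 UV0.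
have [U' [oU' [u U'u] U'U]] := open_trace crX ext oU U0.
have [V' [oV' [v V'v] V'V]] := open_trace crX ext oV V0.
have meets_range (O : set K) : open O -> O !=set0 -> exists x, O (e x).
  by move=> oO O0; have [z [Oz [x _ xz]]] := de _ O0 oO; exists x; rewrite xz.
have UV'0 : U' `&` V' = set0.
  apply/eqP/negPn/negP => /set0P UV'.
  have [x [/U'U Ux /V'V Vx]] := meets_range _ (openI oU' oV') UV'.
  by suff : set0 x by []; rewrite -UV0.
have [A [B [[cA cB] AB [a [Aa U'a]] [b [Bb U'b]] ABV]]] :=
  siK U' V' oU' oV' (ex_intro _ (e u) U'u) (ex_intro _ (e v) V'v) UV'0.
(* Off V' the sets A and B are complementary, so inside U' each of them is
   open and therefore visible in the dense image of X. *)
have meets (C D : set K) c : closed D -> C `|` D = setT -> C `&` D `<=` V' ->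
    C c -> U' c -> (e @^-1` C) `&` U !=set0.
  move=> cD CD CDV Cc U'c.
  have [||x [U'x nDx]] := meets_range (U' `&` ~` D).
  - by apply: openI => //; exact: closed_openC.
  - exists c; split=> // Dc; suff : set0 c by [].
    by rewrite -UV'0; split=> //; exact: CDV.
  - exists x; split; last exact: U'U.
    have : (C `|` D) (e x) by rewrite CD.
    by case.
have ec (C : set K) : closed C -> closed (e @^-1` C).
  by move=> cC; apply: preimage_closed => // x _; exact: ce.
exists (e @^-1` A), (e @^-1` B); split.
- by split; exact: ec.
- by rewrite -preimage_setU AB preimage_setT.
- exact: (meets A B a).
- by apply: (meets B A b) => //; [rewrite setUC | rewrite setIC].
- by move=> x /ABV/V'V.
Qed.

(** If K = A `|` B with A and B proper subcontinua, then a function on X that is 1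
    on one part of the trace of A, 0 on the other, and constant 1/2 on the overlap
    of C and D extends to K and disconnects A. *)
Lemma indecomposable_of_extension (R : realType) (X K : topologicalType)
    (e : X -> K) :
  compact [set: K] -> hausdorff_space K -> continuous e -> dense (range e) ->
  extends_unit_valued R e ->
  strongly_indecomposable X -> connected [set: X] ->
  indecomposable_continuum K.
Proof.
move=> coK hK ce de ext siX conX.
have conK : connected [set: K].
  have <- : closure (range e) = setT.
    apply/seteqP; split=> // y _ N; rewrite nbhsE => -[G [oG Gy] GN].
    have [|z [Gz Rz]] := de G _ oG; first by exists y.
    by exists z; split=> //; exact: GN.
  apply: connected_closure; apply: connected_continuous_connected => //.
  exact: continuous_subspaceT.
split=> // -[A [B [[conA coA] [conB coB] /eqP AT /eqP BT AB]]].
have cA := compact_closed hK coA; have cB := compact_closed hK coB.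
have notall (C : set K) : C <> setT -> exists x, ~ C x.
  move=> CT; apply: contrapT => /forallNP nC; apply: CT.
  by apply/seteqP; split=> // x _; apply: contrapT; exact: nC.
have [u nBu] := notall _ BT; have [v nAv] := notall _ AT.
have BA x : ~ B x -> A x.
  move=> nBx; have : (A `|` B) x by rewrite AB.
  by case.
have meets_range (O : set K) : open O -> O !=set0 -> exists x, O (e x).
  by move=> oO O0; have [z [Oz [x _ xz]]] := de _ O0 oO; exists x; rewrite xz.
have [N nN NA] : exists2 N, nbhs v N & closure N `<=` ~` A.
  apply: (compact_regular hK coK); first exact: filterT.
  by apply: open_nbhs_nbhs; split=> //; exact: closed_openC.
have /(@uniform_separatorP _ R)[psi [cpsi psi01 psiN psiA]] :
    uniform_separator (closure N) A.
  apply: (normal_separatorP (R := R)).1 => //; first exact: compact_normal.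
    exact: closed_closure.
  exact/disjoints_subset.
have {}psiA x : A x -> psi x = 1 by move=> Ax; apply: psiA; exists x.
have {}psi01 x : 0 <= psi x <= 1.
  by have /= := psi01 (psi x); rewrite in_itv/=; apply; exists x.
pose V := N°.
have oV : open V by exact: open_interior.
have VN : V `<=` closure N.
  by apply: subset_trans (@subset_closure _ N); exact: interior_subset.
have psiV x : V x -> psi x = 0 by move=> /VN Nx; apply: psiN; exists x.
have ec (C : set K) : open C -> open (e @^-1` C).
  by move=> cC; apply: open_comp => // x _; exact: ce.
have [||||C [D [[cC cD] CD [a [Ca Ua]] [b [Db Ub]] CDV]]] :=
    siX (e @^-1` (~` B)) (e @^-1` V) _ (ec _ oV).
- by apply: ec; exact: closed_openC.
- by apply: meets_range; [exact: closed_openC | exists u].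
- by apply: meets_range => //; exists v.
- by apply/seteqP; split=> // x [/= /BA Ax /VN /NA].
pose fC x := (1 + psi (e x)) / 2; pose fD x := (1 - psi (e x)) / 2.
have fCD x : C x -> D x -> fC x = fD x.
  by move=> Cx Dx; rewrite /fC /fD psiV ?addr0 ?subr0//; exact: CDV.
pose f : X -> R := patch fD C fC.
have fonC x : C x -> f x = fC x by move=> Cx; rewrite /f /patch mem_set.
have fonD x : D x -> f x = fD x.
  by move=> Dx; rewrite /f /patch; case: ifPn => // /set_mem Cx; exact: fCD.
have ConD x : C x \/ D x by have : [set: X] x by []; rewrite -CD.
have cpsie : continuous (psi \o e).
  by move=> x; apply: continuous_comp; [exact: ce | exact: cpsi].
have cf : continuous f.
  apply: (continuous_patch cC cD) => //.
  - move=> x; apply: cvgM; last exact: cvg_cst.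
    by apply: cvgD; [exact: cvg_cst | exact: cpsie].
  - move=> x; apply: cvgM; last exact: cvg_cst.
    by apply: cvgB; [exact: cvg_cst | exact: cpsie].
  - by move=> x; rewrite inE => -[Cx Dx]; exact: fCD.
have [x|g cg gf] := ext f cf.
  have := psi01 (e x).
  by case: (ConD x) => [/fonC|/fonD] ->; rewrite /fC /fD; lra.
(* The trace of A on X need not be dense in A, so the values of g on A cannot be
   read off from those of f; this relation extends from X to all of K instead. *)
have grel y : (g y - (1 + psi y) / 2) * (g y - (1 - psi y) / 2) = 0.
  pose h y := (g y - (1 + psi y) / 2) * (g y - (1 - psi y) / 2).
  apply: (@dense_range_eq0 _ _ _ e h de) => [z|x]; last first.
    rewrite /h gf; case: (ConD x) => [/fonC|/fonD] ->;
      by rewrite /fC /fD subrr ?mul0r ?mulr0.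
  apply: cvgM; (apply: cvgB; first exact: cg); apply: cvgM.
  - by apply: cvgD; [exact: cvg_cst | exact: cpsi].
  - exact: cvg_cst.
  - by apply: cvgB; [exact: cvg_cst | exact: cpsi].
  - exact: cvg_cst.
apply: (@connected_two_values _ _ A g (e b) (e a) conA cg).
- by move=> y Ay; have := grel y; rewrite psiA// subrr mul0r subr0 mulrC divff.
- exact: BA.
- exact: BA.
- by rewrite gf fonD// /fD psiA ?subrr ?mul0r//; exact: BA.
- by rewrite gf fonC// /fC psiA ?divff//; exact: BA.
Qed.

(** * The Stone-Cech compactification *)

Lemma hausdorff_inj (S T : topologicalType) (f : S -> T) :
  continuous f -> injective f -> hausdorff_space T -> hausdorff_space S.
Proof.
move=> cf fI hT p q pq; apply/fI/hT => M N nM nN.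
by have [x [Mx Nx]] := pq _ _ (cf p _ nM) (cf q _ nN); exists (f x).
Qed.

Lemma set_val_continuous (T : topologicalType) (A : set T) :
  continuous (set_val : set_type A -> T).
Proof. exact: initial_continuous. Qed.

Lemma set_type_hausdorff (T : topologicalType) (A : set T) :
  hausdorff_space T -> hausdorff_space (set_type A).
Proof.
apply: hausdorff_inj; first exact: set_val_continuous.
exact: val_inj.
Qed.

Lemma set_type_compact (T : topologicalType) (A : set T) :
  compact A -> compact [set: set_type A].
Proof.
move=> coA F FF _.
have FA : (set_val @ F) A by apply: nearW => x; exact: set_valP.
have [p [Ap pF]] := coA _ _ FA.
exists (exist _ p (mem_set Ap)); split=> // B N FB [_ [[G oG <-] /= Gp GN]].
have [|y [[x Bx xy] Gy]] := pF (set_val @` B) G _ (open_nbhs_nbhs (conj oG Gp)).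
  by apply: (@filterS _ F _ B) => // x Bx; exists x.
by exists x; split=> //; apply: GN; rewrite /= xy.
Qed.

Lemma prod_topology_continuous (S : topologicalType) (I : eqType)
    (T : I -> topologicalType) (h : S -> prod_topology T) :
  (forall i, continuous (fun x => h x i)) -> continuous h.
Proof.
move=> ch x; apply/cvg_sup => i; apply: continuous_comp_initial.
exact: ch.
Qed.

Section stone_cech_theory.
Context (R : realType) (X : topologicalType).

Lemma unit_interval_hausdorff : hausdorff_space (unit_interval R).
Proof. exact/set_type_hausdorff/Rhausdorff. Qed.

Lemma unit_interval_compact : compact [set: unit_interval R].
Proof. exact/set_type_compact/segment_compact. Qed.

Lemma stone_cech_cube_hausdorff : hausdorff_space (stone_cech_cube R X).
Proof.
apply: (@hausdorff_product (continuousType X (unit_interval R))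
          (fun=> unit_interval R)) => f.
exact: unit_interval_hausdorff.
Qed.

Lemma stone_cech_cube_compact : compact [set: stone_cech_cube R X].
Proof.
have -> : [set: stone_cech_cube R X] =
    [set h | forall f, [set: unit_interval R] (h f)].
  by apply/seteqP; split.
apply: (@tychonoff (continuousType X (unit_interval R))
          (fun=> unit_interval R) (fun=> setT)) => f.
exact: unit_interval_compact.
Qed.

Lemma stone_cech_hausdorff : hausdorff_space (stone_cech R X).
Proof. exact/set_type_hausdorff/stone_cech_cube_hausdorff. Qed.

Lemma stone_cech_compact : compact [set: stone_cech R X].
Proof.
apply: set_type_compact.
exact: (subclosed_compact (@closed_closure _ _) stone_cech_cube_compact).
Qed.

Definition to_stone_cech (x : X) : stone_cech R X :=
  exist _ (@stone_cech_eval R X x)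
    (mem_set (subset_closure (imageT (@stone_cech_eval R X) x))).

Lemma to_stone_cech_continuous : continuous to_stone_cech.
Proof.
apply: continuous_comp_initial; apply: prod_topology_continuous => f.
exact: cts_fun.
Qed.

Lemma to_stone_cech_dense : dense (range to_stone_cech).
Proof.
move=> N [p Np] [G oG GN]; move: Np; rewrite -GN => Gp.
have [y [[x _ xy] Gy]] := set_valP p G (open_nbhs_nbhs (conj oG Gp)).
rewrite -xy in Gy; by exists (to_stone_cech x); split=> //; exists x.
Qed.

(** A unit-valued f is one of the indices of the cube, and the projection of the
    cube to that coordinate extends f. *)
Lemma to_stone_cech_extends : extends_unit_valued R to_stone_cech.
Proof.
move=> f cf f01.
have f01' x : f x \in `[0, 1]%classic by rewrite inE /= in_itv/=.
pose f1 x : unit_interval R := exist _ (f x) (f01' x).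
have cf1 : continuous f1 by exact: continuous_comp_initial.
pose F : continuousType X (unit_interval R) := mkcts cf1.
pose coord (h : stone_cech_cube R X) : unit_interval R := h F.
have ccoord : continuous coord by exact: proj_continuous.
pose g : stone_cech R X -> R := set_val \o (coord \o set_val).
exists g => // p; apply: continuous_comp; last exact: set_val_continuous.
by apply: continuous_comp; [exact: set_val_continuous | exact: ccoord].
Qed.

End stone_cech_theory.

Theorem corollary5 (R : realType) (X : topologicalType)
    (hX : tychonoff_space X) :
  indecomposable_continuum (stone_cech R X) <->
  strongly_indecomposable X /\ connected [set: X].
Proof.
have ce := @to_stone_cech_continuous R X.
have de := @to_stone_cech_dense R X.
have ext := @to_stone_cech_extends R X.
split=> [indec|[siX conX]].
  split; last by apply: (connected_of_extension de ext); case: indec => [[]].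
  apply: (strongly_indecomposable_of_extension hX.1 ce de ext).
  exact: indecomposable_continuum_strongly.
apply: (indecomposable_of_extension _ _ ce de ext siX conX).
  exact: stone_cech_compact.
exact: stone_cech_hausdorff.
Qed.
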